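(* Let $d\ge 1$ and $r_1,\dots,r_d\ge 1$ be integers, and let $P=\prod_{i=1}^d \mathbf{r_i}$ be the product of chains of sizes $r_1,\dots,r_d$. Let $r=\max_i r_i$ and let $k$ be the maximum size of a chain in $P$. In the (unordered) Maker-Breaker chain game on $P$, Maker has a strategy guaranteeing that the elements he chooses contain a chain of size $k-\lfloor r/2\rfloor$, and Breaker has a strategy guaranteeing that the elements Maker chooses contain no chain of size larger than $k-\lfloor r/2\rfloor$.
   Context: The product $\prod_{i=1}^d \mathbf{r_i}$ is the set of integer $d$-tuples $x$ with $0\le x_i<r_i$ for all $i$, ordered by $x\preceq y$ iff $x_i\le y_i$ for all $i$. In the Maker-Breaker chain game on a finite poset, Maker and Breaker alternately (Maker first) choose previously unchosen elements of the poset until all elements are chosen; the question is the largest size of a chain all of whose elements Maker has chosen (in any order). *)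

(* Defs.v *)
From HB Require Import structures.
From mathcomp Require Import all_boot all_order.
Set Implicit Arguments.
Unset Strict Implicit.
Unset Printing Implicit Defensive.
Import Order.TTheory.
Local Open Scope order_scope.

Definition chain_prod (d : nat) (r : 'I_d -> nat) : Type :=
  {dffun forall i : 'I_d, 'I_(r i)}.

HB.instance Definition _ (d : nat) (r : 'I_d -> nat) :=
  Finite.copy (chain_prod r) {dffun forall i : 'I_d, 'I_(r i)}.

Fact chain_prod_display : Order.disp_t. Proof. exact: Order.Disp tt tt. Qed.

Section ChainProdOrder.
Variables (d : nat) (r : 'I_d -> nat).
Implicit Types x y z : chain_prod r.

Definition chain_prod_le x y : bool := [forall i, (x i <= y i)%N].

Fact chain_prod_le_refl : reflexive chain_prod_le.
Proof. by move=> x; apply/forallP. Qed.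

Fact chain_prod_le_anti : antisymmetric chain_prod_le.
Proof.
move=> x y /andP[/forallP xy /forallP yx]; apply/ffunP => i.
by apply/val_inj/anti_leq; rewrite xy yx.
Qed.

Fact chain_prod_le_trans : transitive chain_prod_le.
Proof.
move=> y x z /forallP xy /forallP yz; apply/forallP => i.
exact: leq_trans (xy i) (yz i).
Qed.

HB.instance Definition _ :=
  Order.Le_isPOrder.Build chain_prod_display (chain_prod r)
    chain_prod_le_refl chain_prod_le_anti chain_prod_le_trans.

Lemma leEchain_prod x y : (x <= y) = [forall i, (x i <= y i)%N].
Proof. by []. Qed.

End ChainProdOrder.

Section Chains.
Variables (disp : Order.disp_t) (T : finPOrderType disp).
Implicit Types C M : {set T}.

Definition is_chain C : bool := [forall x in C, forall y in C, x >=< y].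

Definition max_chain_size : nat := \max_(C : {set T} | is_chain C) #|C|.

End Chains.

Arguments max_chain_size {disp} T.

Inductive player := Maker | Breaker.

Section Game.
Variable T : finType.

(* A history lists the elements chosen so far, in the order in which they
   were chosen. *)
Definition to_move (h : seq T) : player :=
  if odd (size h) then Breaker else Maker.

Definition strategy := seq T -> T.

(* Without this condition a strategy repeating elements would be consistent
   with no play at all, and so would vacuously guarantee anything. *)
Definition legal (P : player) (s : strategy) : Prop :=
  forall h : seq T, uniq h -> (size h < #|T|)%N -> to_move h = P -> s h \notin h.

Definition complete_play (p : seq T) : bool := uniq p && (size p == #|T|).

Definition consistent (P : player) (s : strategy) (p : seq T) : Prop :=
  forall (h : seq T) (x : T), prefix (rcons h x) p -> to_move h = P -> x = s h.

Definition maker_set (p : seq T) : {set T} :=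
  [set x in p | ~~ odd (index x p)].

(* The player P has a strategy ensuring that the set of elements chosen by
   Maker (whichever player P is) satisfies W. *)
Definition can_guarantee (P : player) (W : {set T} -> Prop) : Prop :=
  exists2 s : strategy, legal P s &
    forall p : seq T, complete_play p -> consistent P s p -> W (maker_set p).

End Game.

(* Main.v *)
(* Breaker fixes a coordinate i0 with r_i0 = r maximal, pairs x with x + e_i0
   when x_i0 is even, and always answers in the pair that Maker just entered.
   A chain without a full pair is strictly increasing for the rank in which
   x_i0 is replaced by its half, hence misses floor(r/2) of the k ranks.

   Maker starts with the bottom of the truncated diagonal
   D_t = (min(t, r_i - 1))_i, t < r, and answers on the diagonal whenever Breaker
   plays there, so that he loses at most floor(r/2) of its r points. The open
   intervals between D_t and D_(t+1) are disjoint cubes without top and bottom, in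
   each of which Maker gets a point of every rank, although Breaker moves first
   there: when Breaker plays x in such a cube with bottom z, some atom z + e_a is
   not below x, and taking it leaves a smaller cube that Breaker has not touched. *)

Require Import Defs.
From mathcomp Require Import all_boot all_order.
From mathcomp Require Import zify.
Set Implicit Arguments.
Unset Strict Implicit.
Unset Printing Implicit Defensive.
Import Order.TTheory.

(** * Plays, pairing strategies and invariant strategies on a finite set *)

Section Plays.
Variables (T : finType) (x0 : T).
Implicit Types (h p : seq T) (M B : {set T}).

Definition free_move h : T := odflt x0 [pick y | y \notin h].

Lemma free_move_notin h : uniq h -> size h < #|T| -> free_move h \notin h.
Proof.
move=> uh szh; rewrite /free_move; case: pickP => //= noy.
have : #|T| <= size h.
  by rewrite -(card_uniqP uh); apply/subset_leq_card/subsetP => y _;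
    rewrite -[_ \in _]negbK noy.
by rewrite leqNgt szh.
Qed.

Definition breaker_set p : {set T} := [set x in p | odd (index x p)].

Lemma index_last h x : x \notin h -> index x (rcons h x) = size h.
Proof. by move=> xh; rewrite -cats1 index_cat (negPf xh) /= eqxx addn0. Qed.

Lemma index_init h x y : y \in h -> index y (rcons h x) = index y h.
Proof. by move=> yh; rewrite -cats1 index_cat yh. Qed.

Lemma maker_set_rcons h x : x \notin h ->
  maker_set (rcons h x) = if odd (size h) then maker_set h else x |: maker_set h.
Proof.
move=> xh; apply/setP => y.
rewrite (fun_if (fun A : {set T} => y \in A)) !inE mem_rcons inE.
case: (eqVneq y x) => [->|yx] /=.
  by rewrite index_last // (negPf xh); case: (odd (size h)).
by case: (boolP (y \in h)) => [/(@index_init _ x)->|_]; case: (odd (size h)).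
Qed.

Lemma breaker_set_rcons h x : x \notin h ->
  breaker_set (rcons h x) = if odd (size h) then x |: breaker_set h else breaker_set h.
Proof.
move=> xh; apply/setP => y.
rewrite (fun_if (fun A : {set T} => y \in A)) !inE mem_rcons inE.
case: (eqVneq y x) => [->|yx] /=.
  by rewrite index_last // (negPf xh); case: (odd (size h)).
by case: (boolP (y \in h)) => [/(@index_init _ x)->|_]; case: (odd (size h)).
Qed.

Lemma mem_play h x : (x \in h) = (x \in maker_set h) || (x \in breaker_set h).
Proof. by rewrite !inE; case: (x \in h); case: odd. Qed.

Lemma prefix_take_nth p n : n < size p -> prefix (rcons (take n p) (nth x0 p n)) p.
Proof. by move=> np; rewrite -take_nth // prefix_take. Qed.

Lemma uniq_nth_take p n : uniq p -> n < size p -> nth x0 p n \notin take n p.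
Proof.
move=> up np; have := take_uniq n.+1 up.
by rewrite (take_nth x0 np) rcons_uniq => /andP[].
Qed.

Lemma complete_breaker_set p : complete_play p -> breaker_set p = ~: maker_set p.
Proof.
case/andP=> up /eqP szp; apply/setP => x; rewrite !inE.
suff -> : x \in p by rewrite negbK.
have /subset_cardP : #|p| = #|T| by rewrite (card_uniqP up).
by move=> /(_ (subset_predT _))->.
Qed.

Lemma can_guarantee_impl P (V W : {set T} -> Prop) :
  (forall M, V M -> W M) -> can_guarantee P V -> can_guarantee P W.
Proof. by move=> VW [s sl sV]; exists s => // p cp /(sV p cp)/VW. Qed.

(** Breaker answers each move of Maker with its partner if that is free, so Maker cannot come back
    for the second element of a pair. Breaker moves only on nonempty histories, so the default in
    [last x0 h] never occurs. *)
Lemma breaker_pairing (f : T -> T) : involutive f ->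
  can_guarantee Breaker
    (fun M => forall x, x \in M -> f x != x -> f x \notin M).
Proof.
move=> fK.
pose s h := if f (last x0 h) \notin h then f (last x0 h) else free_move h.
exists s => [h uh szh _|p /andP[up _] cons_p].
  by rewrite /s; case: ifP => // _; exact: free_move_notin.
(* Applied to both [x] and [f x], this forces their indices to agree, hence [f x = x]. *)
suff first x : x \in maker_set p -> f x \in maker_set p ->
    ~~ (index x p < index (f x) p).
  move=> x Mx fxx; apply/negP => Mfx.
  have := first _ Mfx; rewrite fK => /(_ Mx); have := first _ Mx Mfx.
  rewrite -!leqNgt => le1 le2.
  have eq_i : index (f x) p = index x p by apply/eqP; rewrite eqn_leq le1.
  move: Mx Mfx; rewrite !inE => /andP[px _] /andP[pfx _].
  have fxE : f x = x by rewrite -(nth_index x0 pfx) eq_i nth_index.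
  by rewrite fxE eqxx in fxx.
rewrite !inE => /andP[px ex] /andP[pfx efx]; apply/negP => lt_i.
have sz1 : (index x p).+1 < size p by apply: leq_ltn_trans lt_i _; rewrite index_mem.
have x_p : index x p < size p by rewrite index_mem.
have := cons_p _ _ (prefix_take_nth sz1).
rewrite /to_move size_takel 1?ltnW //= ex => /(_ erefl).
rewrite /s (take_nth x0 x_p) last_rcons nth_index //.
have fx_h : f x \notin rcons (take (index x p) p) x.
  have := in_take (index x p).+1 pfx.
  by rewrite (take_nth x0 x_p) nth_index // => ->; rewrite -leqNgt.
rewrite fx_h => eq_fx.
(* As Breaker's reply, [f x] sits right after the even position of [x], so it cannot be Maker's. *)
by move: efx; rewrite -eq_fx index_uniq //= ex.
Qed.

(* Replies y already owned by Maker are allowed: they stand for a free move. *)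
Lemma maker_invariant (J : {set T} -> {set T} -> bool) (W : {set T} -> Prop) :
  (forall M M' B, M \subset M' -> J M B -> J M' B) ->
  J [set x0] set0 ->
  (forall M B x, [disjoint M & B] -> x \notin M -> x \notin B -> J M B ->
    exists2 y, y \notin x |: B & J (y |: M) (x |: B)) ->
  (forall M, J M (~: M) -> W M) ->
  can_guarantee Maker W.
Proof.
move=> Jmono Jstart Jreply Jend.
(* The strategy searches for any new element that restores [J]; the proof only has to show that one
   exists in each position reached. *)
pose good h y := (y \notin h) &&
  J (maker_set (rcons h y)) (breaker_set (rcons h y)).
pose s h := if [pick y | good h y] is Some y then y else free_move h.
exists s => [h uh szh _|p cp cons_p].
  rewrite /s; case: pickP => [y /andP[]//|_]; exact: free_move_notin.
have [up /eqP szp] := andP cp.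
have sP h : (exists y, good h y) -> good h (s h).
  by case=> y gy; rewrite /s; case: pickP => [//|/(_ y)]; rewrite gy.
have disj h : [disjoint maker_set h & breaker_set h].
  rewrite -setI_eq0; apply/eqP/setP => x; rewrite !inE.
  by case: (x \in h); case: odd.
have reply n : n.*2.+1 < size p ->
    J (maker_set (take n.*2.+1 p)) (breaker_set (take n.*2.+1 p)) ->
    exists2 y, y \notin breaker_set (take n.*2.+2 p) &
    J (y |: maker_set (take n.*2.+2 p)) (breaker_set (take n.*2.+2 p)).
  move=> np Jn; rewrite (take_nth x0 np).
  have xh := uniq_nth_take up np.
  rewrite maker_set_rcons // breaker_set_rcons // size_takel 1?ltnW //= odd_double /=.
  by apply: Jreply => //; apply: contra xh; rewrite mem_play => ->; rewrite ?orbT.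
have Jn n : n.*2 < size p ->
    J (maker_set (take n.*2.+1 p)) (breaker_set (take n.*2.+1 p)).
  elim: n => [|n IHn] np.
    suff /andP[_] : good [::] (nth x0 p 0) by rewrite (take_nth x0 np) take0.
    rewrite (cons_p [::] (nth x0 p 0)) //; last first.
      by have := prefix_take_nth np; rewrite take0.
    apply: sP; exists x0; rewrite /good maker_set_rcons // breaker_set_rcons //=.
    have -> : breaker_set [::] = set0 by apply/setP => x; rewrite !inE.
    by apply: Jmono Jstart; exact: subsetUl.
  have np1 : n.*2.+1 < size p by apply: ltnW.
  have [y yB Jy] := reply n np1 (IHn (ltnW np1)).
  rewrite doubleS (take_nth x0 np).
  set h := take n.*2.+2 p in yB Jy *.
  have szh : size h = n.*2.+2 by rewrite size_takel // ltnW.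
  have eh : odd (size h) = false by rewrite szh /= odd_double.
  suff /andP[_] : good h (nth x0 p n.*2.+2) by [].
  rewrite (cons_p h _ (prefix_take_nth np)); last by rewrite /to_move eh.
  (* If the proposed [y] is already Maker's, [J] holds before the move and, by monotonicity,
     survives any free move. *)
  apply: sP; case: (boolP (y \in h)) => yh.
    have Jh : J (maker_set h) (breaker_set h).
      move: yh Jy; rewrite mem_play (negPf yB) orbF => yM.
      by rewrite (setUidPr _) // sub1set.
    have uh : uniq h by exact: take_uniq.
    exists (free_move h); rewrite /good.
    have fh : free_move h \notin h by apply: free_move_notin => //; rewrite szh -szp.
    rewrite fh maker_set_rcons // breaker_set_rcons // eh /=.
    by apply: Jmono Jh; exact: subsetUr.
  by exists y; rewrite /good yh maker_set_rcons // breaker_set_rcons // eh.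
apply: Jend; rewrite -complete_breaker_set //.
have p0 : 0 < size p by rewrite szp; apply/card_gt0P; exists x0.
(* For odd size the last move is Maker's. For even size it is Breaker's, and the reply [y], not
   being Breaker's on a full board, is already Maker's. *)
have [] := boolP (odd (size p)) => op.
  have e : size p = (size p)./2.*2.+1 by rewrite -[LHS]odd_double_half op.
  by have := Jn (size p)./2; rewrite -e take_size => /(_ (leqnn _)).
have e : size p = (size p).-1./2.*2.+2 by lia.
set n := (size p).-1./2 in e.
have np : n.*2.+1 < size p by rewrite -e.
have [y yB Jy] := reply n np (Jn n (ltnW np)).
move: yB Jy; rewrite -e take_size complete_breaker_set // inE negbK => yM.
by rewrite (setUidPr _) // sub1set.
Qed.

End Plays.

(** * Rank and unit steps in a product of chains *)

Section Products.
Variables (d : nat) (r : 'I_d -> nat).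
Notation P := (chain_prod r).
Implicit Types (x y z u v w : P) (M B C D : {set P}).

Definition rank x := \sum_i (x i : nat).

Lemma le_coord x y i : (x <= y)%O -> x i <= y i.
Proof. by rewrite leEchain_prod => /forallP. Qed.

Lemma chain_prodP x y : (forall i, x i = y i :> nat) -> x = y.
Proof. by move=> xy; apply/ffunP => i; apply/val_inj/xy. Qed.

Lemma lt_coord x y : (x < y)%O -> exists i, x i < y i.
Proof.
move=> xy; apply/existsP; rewrite -[[exists _, _]]negbK; apply/negP => /existsPn nlt.
suff eq_xy : x = y by rewrite eq_xy ltxx in xy.
apply: chain_prodP => i; apply/eqP; rewrite eqn_leq le_coord ?(ltW xy) //=.
by rewrite leqNgt nlt.
Qed.

(** General coordinate weights cover both the usual rank and the rank with one coordinate halved. *)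
Lemma sum_mono (f : forall i : 'I_d, 'I_(r i) -> nat) x y :
  (forall i, f i (x i) <= f i (y i)) -> (exists i, f i (x i) < f i (y i)) ->
  \sum_i f i (x i) < \sum_i f i (y i).
Proof.
move=> le_f [i lt_f]; rewrite (bigD1 i) //= [ltnRHS](bigD1 i) //=.
by rewrite -addSn leq_add // leq_sum.
Qed.

Lemma rank_mono x y : (x < y)%O -> rank x < rank y.
Proof.
move=> xy; apply: (sum_mono (f := fun i => @nat_of_ord (r i))); last exact: lt_coord.
by move=> i; rewrite le_coord ?ltW.
Qed.

(** On a chain, a strictly increasing [f] is injective, with values in ['I_n.+1]. *)
Lemma chain_card_le (f : P -> nat) n C : is_chain C ->
  {in C &, forall x y, (x < y)%O -> f x < f y} ->
  {in C, forall x, f x <= n} -> #|C| <= n.+1.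
Proof.
move=> /forall_inP chC f_mono f_le.
pose g x : 'I_n.+1 := inord (f x).
have g_inj : {in C &, injective g}.
  move=> x y Cx Cy /(congr1 (@nat_of_ord _)); rewrite !inordK ?ltnS ?f_le // => eq_f.
  have /forall_inP/(_ y Cy)/orP := chC x Cx.
  by case; rewrite le_eqVlt => /predU1P[// | lt]; 
    [have := f_mono x y Cx Cy lt | have := f_mono y x Cy Cx lt]; rewrite eq_f ltnn.
by rewrite -(card_in_imset g_inj) -[X in _ <= X]card_ord max_card.
Qed.

Definition shift_up x (a : 'I_d) : P :=
  [ffun j => insubd (x j) (x j + (j == a))].

Lemma shift_upE x a j : x a + 1 < r a -> shift_up x a j = x j + (j == a) :> nat.
Proof.
move=> xa; rewrite ffunE val_insubd; case: eqVneq => [->|ja]; first by rewrite xa.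
by rewrite addn0 ltn_ord.
Qed.

Lemma shift_up_spec x w a : (x <= w)%O -> x a < w a ->
  [/\ (x < shift_up x a)%O, (shift_up x a <= w)%O,
      rank (shift_up x a) = (rank x).+1 & shift_up x a a = (x a).+1 :> nat].
Proof.
move=> xw xa.
have xar : x a + 1 < r a by rewrite addn1; apply: leq_trans (ltn_ord (w a)).
have rk : rank (shift_up x a) = (rank x).+1.
  rewrite /rank (eq_bigr (fun j => x j + (j == a))) => [|j _]; last exact: shift_upE.
  rewrite big_split /= -addn1; congr (_ + _).
  by rewrite (bigD1 a) //= eqxx big1 // => j /negPf->.
have sE := shift_upE _ xar; split=> //; last by rewrite sE eqxx addn1.
  rewrite lt_neqAle; apply/andP; split.
    by apply/eqP => e; have := n_Sn (rank x); rewrite -rk -e.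
  by rewrite leEchain_prod; apply/forallP => j; rewrite sE leq_addr.
rewrite leEchain_prod; apply/forallP => j; rewrite sE.
by case: eqVneq => [->|_]; rewrite ?addn1 ?addn0 ?le_coord.
Qed.

(** * Chains of Maker between two points *)

(* e bounds the number of ranks in ]u, v] that the chain misses. *)
Definition linked M u v e : bool :=
  [exists C : {set P}, [&& is_chain C, C \subset M,
     [forall x in C, (u < x)%O && (x <= v)%O] & rank v <= #|C| + rank u + e]].

Lemma linkedP M u v e :
  reflect (exists C, [/\ is_chain C, C \subset M,
     {in C, forall x, (u < x)%O && (x <= v)%O} & rank v <= #|C| + rank u + e])
    (linked M u v e).
Proof.
apply: (iffP existsP) => -[C].
  by case/and4P=> chC CM /forall_inP bC rkC; exists C; split.
by case=> chC CM bC rkC; exists C; rewrite chC CM rkC andbT; apply/forall_inP.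
Qed.

Lemma sub_linked M M' u v e : M \subset M' -> linked M u v e -> linked M' u v e.
Proof.
move=> sM /linkedP[C [chC CM bC rkC]]; apply/linkedP; exists C; split=> //.
exact: subset_trans sM.
Qed.

Lemma linked_refl M u : linked M u u 0.
Proof.
apply/linkedP; exists set0; split; rewrite ?sub0set ?cards0 ?addn0 //.
  by apply/forall_inP => x; rewrite inE.
by move=> x; rewrite inE.
Qed.

Lemma linked_step M u v : (u < v)%O -> rank v <= (rank u).+1 -> v \in M ->
  linked M u v 0.
Proof.
move=> uv rk Mv; apply/linkedP; exists [set v]; split.
- apply/forall_inP => x /set1P->; apply/forall_inP => y /set1P->.
  exact: comparablexx.
- by rewrite sub1set.
- by move=> x /set1P->; rewrite uv lexx.
- by rewrite cards1 addn0.
Qed.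

(** Since the intervals are half-open, the two chains are disjoint and stacked, so sizes and defects
    add. *)
Lemma linked_trans M u v w e f : (u <= v)%O -> (v <= w)%O ->
  linked M u v e -> linked M v w f -> linked M u w (e + f).
Proof.
move=> uv vw /linkedP[C [chC CM bC rkC]] /linkedP[D [chD DM bD rkD]].
apply/linkedP; exists (C :|: D); split.
- have cmp x y : x \in C -> y \in D -> (x <= y)%O.
    by move=> /bC/andP[_ xv] /bD/andP[/ltW vy _]; exact: le_trans vy.
  move/forall_inP: chC => chC; move/forall_inP: chD => chD.
  apply/forall_inP => x /setUP[] xX; apply/forall_inP => y /setUP[] yY.
  + exact: (forall_inP (chC x xX)).
  + by rewrite /Order.comparable cmp.
  + by rewrite /Order.comparable (cmp y x) ?orbT.
  + exact: (forall_inP (chD x xX)).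
- by rewrite subUset CM.
- move=> x /setUP[/bC|/bD] /andP[lt le]; first by rewrite lt (le_trans le).
  by rewrite le (le_lt_trans uv).
- rewrite cardsU (_ : C :&: D = set0) ?cards0 ?subn0; first by lia.
  apply/setP => x; rewrite !inE; apply/andP => -[/bC/andP[_ xv] /bD/andP[vx _]].
  by have := le_lt_trans xv vx; rewrite ltxx.
Qed.

(** Climb from [z] to [w] by unit steps; each one raises the rank by exactly one. *)
Lemma linked_full M z w : (z <= w)%O ->
  (forall x, (z < x)%O -> (x <= w)%O -> x \in M) -> linked M z w 0.
Proof.
have [n] := ubnP (rank w - rank z); elim: n z => // n IHn z rk zw fullM.
move: (zw); rewrite le_eqVlt => /predU1P[->|lt_zw]; first exact: linked_refl.
have [a za] := lt_coord lt_zw.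
have [lt_zy yw rky _] := shift_up_spec zw za.
apply: (@linked_trans _ _ (shift_up z a) _ 0 0) => //; first exact: ltW.
  by apply: linked_step; rewrite ?rky ?fullM.
apply: IHn => //; first by have := rank_mono lt_zw; lia.
by move=> x yx; apply: fullM; exact: lt_trans yx.
Qed.

Lemma linked_drop M u w : linked (w |: M) u w 0 -> linked M u w (w \notin M).
Proof.
case: (boolP (w \in M)) => [Mw|_]; first by rewrite (setUidPr _) ?sub1set.
case/linkedP=> C [chC CM bC rkC]; apply/linkedP; exists (C :\ w); split.
- move/forall_inP: chC => chC; apply/forall_inP => x /setD1P[_ Cx].
  apply/forall_inP => y /setD1P[_ Cy]; exact: (forall_inP (chC x Cx)).
- by rewrite subDset.
- by move=> x /setD1P[_ /bC].
- apply: leq_trans rkC _.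
  by rewrite (cardsD1 w C) addn0 addn1 -addnA -add1n leq_add2r leq_b1.
Qed.

(** * Maker's play inside one cube *)

(* z is the top of the chain that Maker has built so far upwards from u. *)
Definition segment_ok M B u w : bool :=
  [exists z, [&& (u <= z)%O, (z <= w)%O, linked M u z 0 &
    [forall x in B, ~~ ((z < x)%O && (x < w)%O)]]].

Lemma segment_okP M B u w :
  reflect (exists z, [/\ (u <= z)%O, (z <= w)%O, linked M u z 0 &
    forall x, x \in B -> (z < x)%O -> (x < w)%O -> False]) (segment_ok M B u w).
Proof.
apply: (iffP existsP) => -[z].
  case/and4P=> uz zw lz /forall_inP Bz; exists z; split=> // x /Bz.
  by move=> /negP nzx zx xw; apply: nzx; rewrite zx.
case=> uz zw lz Bz; exists z; rewrite uz zw lz; apply/forall_inP => x Bx.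
by apply/negP => /andP[]; exact: Bz.
Qed.

Lemma segment_start M u w : (u <= w)%O -> segment_ok M set0 u w.
Proof.
move=> uw; apply/segment_okP; exists u; split=> //; first exact: linked_refl.
by move=> x; rewrite inE.
Qed.

Lemma sub_segment M M' B u w : M \subset M' ->
  segment_ok M B u w -> segment_ok M' B u w.
Proof.
move=> sM /segment_okP[z [uz zw lz Bz]]; apply/segment_okP; exists z; split=> //.
exact: sub_linked lz.
Qed.

Lemma segment_outside M B u w x : ~~ ((u < x)%O && (x < w)%O) ->
  segment_ok M B u w -> segment_ok M (x |: B) u w.
Proof.
move=> nx /segment_okP[z [uz zw lz Bz]]; apply/segment_okP; exists z; split=> //.
move=> y /setU1P[->|]; last exact: Bz.
by move=> zx xw; move: nx; rewrite xw (le_lt_trans uz zx).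
Qed.

(* When [u, w] is a cube, raising z in a coordinate where x is minimal leaves
   Breaker's new element x outside the remaining interval. *)
Lemma segment_reply M B u w x y0 :
  (forall i, w i <= (u i).+1) -> y0 \notin x |: B -> segment_ok M B u w ->
  exists2 y, y \notin x |: B & segment_ok (y |: M) (x |: B) u w.
Proof.
move=> cube y0xB /[dup] ok /segment_okP[z [uz zw lz Bz]].
have [/andP[zx xw]|nzx] := boolP ((z < x)%O && (x < w)%O); last first.
  exists y0 => //; apply/segment_okP; exists z; split=> //.
    by apply: sub_linked lz; exact: subsetUr.
  move=> y /setU1P[-> zx xw|]; last exact: Bz.
  by rewrite zx xw in nzx.
have [a xa] := lt_coord xw.
have za : z a < w a by apply: leq_ltn_trans xa; rewrite le_coord ?ltW.
have [zy yw rky ya] := shift_up_spec zw za.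
set y := shift_up z a in zy yw rky ya *.
(* In coordinate [a], the cube condition gives [x a < w a <= (u a).+1 <= (z a).+1 = y a]. *)
have nyx : ~~ (y <= x)%O.
  apply/negP => /(@le_coord _ _ a); rewrite ya ltnNge => /negP; apply.
  by have := le_coord a uz; have := cube a; lia.
(* The rank of [x] lies strictly between those of [z] and [w], so one unit step from [z] cannot
   reach [w]. *)
have y_lt_w : (y < w)%O.
  rewrite lt_neqAle yw andbT; apply/eqP => yw'.
  by have := rank_mono zx; have := rank_mono xw; rewrite -yw' rky; lia.
exists y.
  rewrite !inE negb_or; apply/andP; split.
    by apply: contraNneq nyx => ->.
  by apply/negP => By; exact: Bz By zy y_lt_w.
apply/segment_okP; exists y; split=> //.
- exact: le_trans (ltW zy).
- apply: (@linked_trans _ _ z _ 0 0) => //; first exact: ltW.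
    by apply: sub_linked lz; exact: subsetUr.
  by apply: linked_step; rewrite ?rky ?setU11.
- move=> x' /setU1P[-> /ltW yx _|Bx' yx']; first by rewrite yx in nyx.
  by apply: Bz => //; exact: lt_trans yx'.
Qed.

(** At the end everything strictly between [z] and [w] is Maker's, so the chain extends upwards and
    only [w] itself can be missing; the boolean counts this loss. *)
Lemma segment_end M u w : segment_ok M (~: M) u w -> linked M u w (w \notin M).
Proof.
case/segment_okP=> z [uz zw lz Bz]; apply: linked_drop.
apply: (@linked_trans _ _ z _ 0 0) => //.
  by apply: sub_linked lz; exact: subsetUr.
apply: linked_full => // x zx; rewrite le_eqVlt => /predU1P[->|xw]; first exact: setU11.
rewrite !inE; case: (boolP (x \in M)); rewrite ?orbT // => nMx.
by case: (Bz x); rewrite ?inE.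
Qed.

(** * Securing half of a set *)

(* The invariant on a set D of which Maker is to get at least half: Breaker is
   behind, or D is exhausted. *)
Definition ahead D M B : bool :=
  (#|D :&: B| <= #|D :&: M|) && ((#|D :&: B| < #|D :&: M|) || (D \subset M :|: B)).

Lemma sub_ahead D M M' B : M \subset M' -> ahead D M B -> ahead D M' B.
Proof.
move=> sM /andP[le1 /orP lt1]; rewrite /ahead.
have le2 : #|D :&: M| <= #|D :&: M'| by rewrite subset_leq_card ?setIS.
rewrite (leq_trans le1 le2); case: lt1 => [lt1|sD].
  by rewrite (leq_trans lt1 le2).
by apply/orP; right; apply: subset_trans sD _; exact: setSU.
Qed.

Lemma ahead_outside D M B x : x \notin D -> ahead D M B -> ahead D M (x |: B).
Proof.
move=> Dx; rewrite /ahead.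
have -> : D :&: (x |: B) = D :&: B.
  apply/setP => y; rewrite !inE; case: eqVneq => // ->; by rewrite (negPf Dx).
case/andP=> -> /orP[->//|sD]; apply/orP; right; apply: subset_trans sD _.
by rewrite setUCA subsetUr.
Qed.

Lemma ahead_reply D M B x y0 :
  x \in D -> x \notin M -> x \notin B -> y0 \notin x |: B -> ahead D M B ->
  exists2 y, y \notin x |: B & ahead D (y |: M) (x |: B).
Proof.
(* Before the move [x] was a free element of [D], so [D] was not exhausted and Maker was strictly
   ahead. *)
move=> Dx Mx Bx y0xB /andP[_ /orP[lt1|/subsetP/(_ x Dx)]]; last first.
  by rewrite inE (negPf Mx) (negPf Bx).
have le1 : #|D :&: (x |: B)| <= #|D :&: M|.
  apply: leq_trans lt1; rewrite setIUr (leq_trans (leq_card_setU _ _)) // -add1n.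
  by rewrite leq_add2r -(cards1 x) subset_leq_card ?subsetIr.
(* A free element of [D] restores the lead; if there is none, [D] is exhausted and being level
   suffices. *)
have [y|none] := pickP [pred y in D | y \notin M :|: (x |: B)].
  rewrite inE => /andP[Dy]; rewrite inE negb_or => /andP[My yxB]; exists y => //.
  have lt2 : #|D :&: M| < #|D :&: (y |: M)|.
    apply: proper_card; apply/properP; split; first by rewrite setIS ?subsetUr.
    by exists y; rewrite !inE ?Dy ?eqxx // (negPf My) andbF.
  by rewrite /ahead (leq_ltn_trans le1 lt2) ltnW // (leq_ltn_trans le1 lt2).
exists y0 => //; apply: (@sub_ahead _ M); first exact: subsetUr.
rewrite /ahead le1; apply/orP; right; apply/subsetP => y Dy.
by have /= := none y; rewrite Dy /= => /negbFE.
Qed.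

Lemma ahead_end D M : ahead D M (~: M) -> #|D :\: M| <= #|D| %/ 2.
Proof.
by case/andP=> + _; rewrite -setDE; have := cardsID M D; lia.
Qed.

(** * The truncated diagonal and the maximum chain size *)

Section Strategies.
Hypothesis r_gt0 : forall i, 0 < r i.

Fact diag_subproof t i : minn t (r i).-1 < r i.
Proof. by rewrite (leq_ltn_trans (geq_minr _ _)) // prednK. Qed.

Definition diag t : P := [ffun i => Ordinal (diag_subproof t i)].

Lemma diagE t i : diag t i = minn t (r i).-1 :> nat.
Proof. by rewrite ffunE. Qed.

Lemma diag_le s t : s <= t -> (diag s <= diag t)%O.
Proof.
by move=> st; rewrite leEchain_prod; apply/forallP => i; rewrite !diagE; lia.
Qed.

Lemma diag_cube t i : diag t.+1 i <= (diag t i).+1.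
Proof. by rewrite !diagE; lia. Qed.

(** If [s < t], then [diag s.+1] is below [diag t]. So one move of Breaker disturbs at most one
    cube. *)
Lemma diag_between s t x :
  (diag t < x)%O && (x < diag t.+1)%O -> (diag s < x)%O && (x < diag s.+1)%O -> s = t.
Proof.
have aux a b : a < b -> (x < diag a.+1)%O -> (diag b < x)%O -> False.
  by move=> /diag_le ab xa bx; have := lt_trans (lt_le_trans xa ab) bx; rewrite ltxx.
move=> /andP[tx xt] /andP[sx xs]; case: (ltngtP s t) => [lt_st|lt_st|//].
  by case: (aux _ _ lt_st).
by case: (aux _ _ lt_st).
Qed.

Lemma diag_not_between s t : ~~ ((diag t < diag s)%O && (diag s < diag t.+1)%O).
Proof.
apply/andP => -[ts st]; case: (leqP s t) => [/diag_le|/diag_le] le_st.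
  by have := lt_le_trans ts le_st; rewrite ltxx.
by have := lt_le_trans st le_st; rewrite ltxx.
Qed.

Section MaxCoordinate.
Variable i0 : 'I_d.
Hypothesis r_le : forall i, r i <= r i0.

Notation n := (r i0).

Lemma le_diag_top x : (x <= diag n.-1)%O.
Proof.
rewrite leEchain_prod; apply/forallP => i; rewrite diagE.
by have := ltn_ord (x i); have := r_le i; lia.
Qed.

Lemma rank_bot : rank (diag 0) = 0.
Proof. by rewrite /rank big1 // => i _; rewrite diagE min0n. Qed.

Lemma rank_top : rank (diag n.-1) = \sum_i (r i).-1.
Proof. by apply: eq_bigr => i _; rewrite diagE; have := r_le i; lia. Qed.

(** Below [n], the coordinate [i0] is never truncated. *)
Lemma diag_inj : {in gtn n &, injective diag}.
Proof.
move=> s t; rewrite !inE => sn tn /(congr1 (fun x : P => x i0 : nat)).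
by rewrite !diagE; lia.
Qed.

(** [linked] leaves out its lower end; adding [diag 0] back accounts for the extra one. *)
Lemma linked_chain M e : diag 0 \in M -> linked M (diag 0) (diag n.-1) e ->
  exists C, [/\ is_chain C, C \subset M & rank (diag n.-1) + 1 <= #|C| + e].
Proof.
move=> M0 /linkedP[C [/forall_inP chC CM bC rkC]]; exists (diag 0 |: C); split.
- have cmp x : x \in C -> (diag 0 <= x)%O by move=> /bC/andP[/ltW].
  apply/forall_inP => x /setU1P[->|Cx]; apply/forall_inP => y /setU1P[->|Cy].
  + exact: comparablexx.
  + by rewrite /Order.comparable cmp.
  + by rewrite /Order.comparable (cmp x) ?orbT.
  + exact: (forall_inP (chC x Cx)).
- by rewrite subUset sub1set M0.
- have nC : diag 0 \notin C by apply/negP => /bC; rewrite ltxx.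
  by rewrite cardsU1 nC; move: rkC; rewrite rank_bot; lia.
Qed.

(** The rank gives the upper bound; a climb from bottom to top through [setT] attains it. *)
Lemma max_chain_sizeE : max_chain_size P = (\sum_i (r i).-1).+1.
Proof.
rewrite -rank_top; apply/eqP; rewrite eqn_leq; apply/andP; split.
  apply/bigmax_leqP => C chC; apply: (chain_card_le (f := rank)) => //.
    by move=> x y _ _; exact: rank_mono.
  move=> x _; have := le_diag_top x; rewrite le_eqVlt => /predU1P[->//|].
  by move/rank_mono/ltnW.
have [||C [chC _]] := @linked_chain setT 0.
- exact: in_setT.
- by apply: linked_full => [|x]; rewrite ?diag_le ?inE.
rewrite addn1 addn0 => /leq_trans; apply.
exact: (@leq_bigmax_cond _ (@is_chain _ _) (fun C => #|C|)).
Qed.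

(** * Maker's invariant on the whole product *)

Definition diagonal : {set P} := [set diag (t : nat) | t : 'I_n].

Lemma mem_diagonal t : t < n -> diag t \in diagonal.
Proof. by move=> tn; apply/imsetP; exists (Ordinal tn). Qed.

(** For [t = n.-1] the segment is degenerate: both ends are the top of the product. *)
Definition invariant M B : bool :=
  [&& diag 0 \in M, ahead diagonal M B
    & [forall t : 'I_n, segment_ok M B (diag t) (diag t.+1)]].

Lemma sub_invariant M M' B : M \subset M' -> invariant M B -> invariant M' B.
Proof.
move=> sM /and3P[M0 aM /forallP sg]; apply/and3P; split.
- exact: (subsetP sM).
- exact: sub_ahead aM.
- by apply/forallP => t; exact: sub_segment (sg t).
Qed.

Lemma invariant_start : invariant [set diag 0] set0.
Proof.
apply/and3P; split; first by rewrite set11.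
  rewrite /ahead setI0 cards0 /= card_gt0; apply/orP; left.
  by apply/set0Pn; exists (diag 0); rewrite inE set11 mem_diagonal.
by apply/forallP => t; rewrite segment_start ?diag_le.
Qed.

(** Breaker's move lies on the diagonal, inside exactly one cube, or in neither; only the component
    concerned needs an answer. Whenever any reply will do, [diag 0], already Maker's, stands for a
    free move. *)
Lemma invariant_reply M B x :
  [disjoint M & B] -> x \notin M -> x \notin B -> invariant M B ->
  exists2 y, y \notin x |: B & invariant (y |: M) (x |: B).
Proof.
move=> dMB Mx Bx /and3P[M0 aM /forallP sg].
have B0 : diag 0 \notin x |: B.
  rewrite !inE negb_or (disjointFr dMB M0) andbT.
  by apply: contraNneq Mx => <-.
have subU y : M \subset y |: M by exact: subsetUr.
have M0U y : diag 0 \in y |: M by exact: (subsetP (subU y)).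
have [Dx|nDx] := boolP (x \in diagonal).
  have [y yB ay] := ahead_reply Dx Mx Bx B0 aM; exists y => //.
  apply/and3P; split=> //; apply/forallP => t.
  apply: (sub_segment (subU y)); apply: segment_outside (sg t).
  by case/imsetP: Dx => s _ ->; exact: diag_not_between.
have aU y : ahead diagonal (y |: M) (x |: B).
  by apply: (sub_ahead (subU y)); exact: ahead_outside.
have [t xt|none] := pickP (fun t : 'I_n => (diag t < x)%O && (x < diag t.+1)%O).
  have [y yB sy] := segment_reply (diag_cube t) B0 (sg t); exists y => //.
  apply/and3P; split=> //; apply/forallP => s.
  have [xs|nxs] := boolP ((diag s < x)%O && (x < diag s.+1)%O).
    by rewrite (diag_between xt xs).
  by apply: (sub_segment (subU y)); apply: segment_outside (sg s).
exists (diag 0) => //; apply/and3P; split=> //; apply/forallP => s.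
by apply: (sub_segment (subU _)); apply: segment_outside (sg s); rewrite none.
Qed.

Lemma invariant_end M : invariant M (~: M) ->
  exists C, [/\ is_chain C, C \subset M & max_chain_size P - n %/ 2 <= #|C|].
Proof.
case/and3P=> M0 aM /forallP sg.
have link m : m < n -> linked M (diag 0) (diag m) (\sum_(t < m) (diag t.+1 \notin M)).
  elim: m => [|m IHm] mn; first by rewrite big_ord0 linked_refl.
  rewrite big_ord_recr; apply: (linked_trans _ _ (IHm (ltnW mn))); rewrite ?diag_le //.
  exact: segment_end (sg (Ordinal (ltnW mn))).
have n1 : n.-1 < n by rewrite prednK.
have [C [chC CM leC]] := linked_chain M0 (link _ n1); exists C; split=> //.
have missed : \sum_(t < n.-1) (diag t.+1 \notin M) <= n %/ 2.
  (* The added term for [diag 0] is zero, as Maker owns the bottom. *)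
  have -> : \sum_(t < n.-1) (diag t.+1 \notin M) = \sum_(t < n) (diag t \notin M).
    have := erefl (\sum_(t < n.-1.+1) (diag t \notin M)).
    by rewrite {1}big_ord_recl M0 /= add0n prednK.
  have := ahead_end aM.
  have -> : #|diagonal| = n.
    rewrite card_in_imset ?card_ord // => s t _ _ /diag_inj eq_st.
    by apply/val_inj/eq_st; rewrite inE.
  apply: leq_trans; rewrite -big_mkcond /= sum1dep_card.
  rewrite -(@card_in_imset _ _ (fun t : 'I_n => diag t)) => [|s t _ _ /diag_inj eq_st].
    apply/subset_leq_card/subsetP => _ /imsetP[t + ->].
    by rewrite !inE => ->; rewrite mem_diagonal.
  by apply/val_inj/eq_st; rewrite inE.
by rewrite max_chain_sizeE -rank_top; lia.
Qed.

(** * Breaker's pairing along a longest coordinate *)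

Definition swap_nat (k m : nat) := if odd m then m.-1 else if m.+1 < k then m.+1 else m.

Lemma swap_natK k m : m < k -> swap_nat k (swap_nat k m) = m.
Proof.
move=> mk; rewrite {2}/swap_nat; case: (boolP (odd m)) => om.
  case: m om mk => //= m om mk; by rewrite /swap_nat (negPf om) mk.
case: (ltnP m.+1 k) => mk1; first by rewrite /swap_nat /= om.
by rewrite /swap_nat (negPf om) ltnNge mk1.
Qed.

(* If r i0 is odd, the points whose i0-coordinate is maximal stay unpaired. *)
Definition swap x : P :=
  [ffun i => insubd (x i) (if i == i0 then swap_nat (r i) (x i) else x i)].

Lemma swapE x i :
  swap x i = (if i == i0 then swap_nat (r i) (x i) else x i) :> nat.
Proof.
rewrite ffunE val_insubd.
suff -> : (if i == i0 then swap_nat (r i) (x i) else x i) < r i by [].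
have lt_x := ltn_ord (x i); case: ifP => // _; rewrite /swap_nat.
by case: ifP => _; [exact: leq_ltn_trans (leq_pred _) lt_x | case: ifP].
Qed.

Lemma swapK : involutive swap.
Proof.
move=> x; apply: chain_prodP => i; rewrite !swapE; case: eqP => // _.
by rewrite swap_natK.
Qed.

(* Replacing the i0-coordinate by its half in the rank keeps it strictly
   increasing along a chain that contains no two paired points. *)
Lemma swap_free_chain C : is_chain C ->
  {in C, forall x, swap x != x -> swap x \notin C} ->
  #|C| <= max_chain_size P - n %/ 2.
Proof.
move=> chC freeC.
pose f i (a : 'I_(r i)) := if i == i0 then a./2 else a : nat.
have mono x y i : (x <= y)%O -> f i (x i) <= f i (y i).
  by move=> /(@le_coord _ _ i); rewrite /f; case: ifP => // _; lia.
(* The top has the largest halved rank, and [n.-1 - n %/ 2 = n.-1./2]. *)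
have -> : max_chain_size P - n %/ 2 = (\sum_i f i (diag n.-1 i)).+1.
  rewrite max_chain_sizeE (bigD1 i0) //= [in RHS](bigD1 i0) //=.
  rewrite [X in _ = (_ + X).+1](eq_bigr (fun i => (r i).-1)).
    by rewrite /f eqxx diagE minnn; have := r_gt0 i0; lia.
  by move=> i /negPf ni; rewrite /f ni diagE; have := r_le i; lia.
apply: (chain_card_le (f := fun x => \sum_i f i (x i))) => //; last first.
  by move=> x _; apply: leq_sum => i _; apply/mono/le_diag_top.
move=> x y Cx Cy xy; apply: sum_mono => [i|]; first exact/mono/ltW.
apply/existsP; rewrite -[[exists _, _]]negbK; apply/negP => /existsPn nlt.
(* If no term increases, [x] and [y] differ only at [i0], where they have equal halves: they form a
   pair. *)
have eq_f i : f i (x i) = f i (y i).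
  by apply/eqP; rewrite eqn_leq mono ?(ltW xy) // leqNgt nlt.
have [i lt_i] := lt_coord xy.
have ii0 : i = i0.
  by apply/eqP; have := eq_f i; rewrite /f; case: eqP => // _ e; rewrite e ltnn in lt_i.
rewrite {i}ii0 in lt_i.
have eq_y : swap x = y.
  apply: chain_prodP => i; rewrite swapE; have := eq_f i; rewrite /f.
  case: eqP => // ->; rewrite /swap_nat; have := ltn_ord (y i0).
  by do ![case: ifP]; lia.
have := freeC x Cx; rewrite eq_y Cy => /implyP.
by rewrite implybF negbK => /eqP yx; rewrite yx ltxx in xy.
Qed.

End MaxCoordinate.
End Strategies.
End Products.

(** * The two strategies combined *)

Theorem theorem1 (d : nat) (r : 'I_d -> nat) (hd : 1 <= d)
    (hr : forall i : 'I_d, 1 <= r i) :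
  let k := max_chain_size (chain_prod r) in
  let rmax := \max_(i < d) r i in
  can_guarantee Maker (fun M : {set chain_prod r} =>
    exists C : {set chain_prod r},
      [/\ is_chain C, C \subset M & #|C| = k - rmax %/ 2])
  /\
  can_guarantee Breaker (fun M : {set chain_prod r} =>
    forall C : {set chain_prod r},
      is_chain C -> C \subset M -> #|C| <= k - rmax %/ 2).
Proof.
move=> k rmax.
have d_gt0 : 0 < #|'I_d| by rewrite card_ord.
have [i0 rmaxE] := bigop.eq_bigmax r d_gt0.
have r_le i : r i <= r i0 by rewrite -rmaxE leq_bigmax.
rewrite /rmax rmaxE /k; split.
  apply: (maker_invariant (x0 := diag hr 0) (J := invariant hr i0)).
  - exact: sub_invariant.
  - exact: invariant_start.
  - exact: invariant_reply.
  move=> M /(invariant_end r_le)[C [/forall_inP chC CM]].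
  (* The chain found may be too large, so it is cut down to the exact size. *)
  case/card_geqP=> s [us szs sC]; exists [set x in s]; split.
  - apply/forall_inP => x; rewrite inE => /sC Cx.
    by apply/forall_inP => y; rewrite inE => /sC; exact: (forall_inP (chC x Cx)).
  - by apply/subsetP => x; rewrite inE => /sC; exact: (subsetP CM).
  - by rewrite cardsE (card_uniqP us).
apply: can_guarantee_impl (breaker_pairing (diag hr 0) (swapK i0)) => M freeM C chC CM.
apply: (swap_free_chain hr r_le chC) => x /(subsetP CM) Mx nx.
by apply: contra (freeM x Mx nx); exact: (subsetP CM).
Qed.
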